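(* Let $L$ be a Noether lattice. Let $0\neq q\in L$ be a non-nilpotent proper element satisfying the restricted cancellation law. Then the following are equivalent: (i) for every integer $n\geqslant 2$, $q$ is $\phi$-$\delta$-primary for some function $\phi:L\to L$ with $\phi\leqslant\phi_n$; (ii) $q$ is $\delta$-primary.
   Context: A multiplicative lattice is a complete lattice (least element $0$, greatest element $1$) with a commutative, associative multiplication that distributes over arbitrary joins and for which $1$ is the identity. For $a,b\in L$, $(a:b)=\bigvee\{x\in L\mid xb\leqslant a\}$. An element $e$ is meet principal if $a\wedge be=((a:e)\wedge b)e$ for all $a,b$, join principal if $(ae\vee b):e=(b:e)\vee a$ for all $a,b$, and principal if both. $L$ is principally generated if every element is a join of principal elements. A Noether lattice is a modular, principally generated multiplicative lattice satisfying the ascending chain condition. An element $a$ of a Noether lattice satisfies the restricted cancellation law if for all $b,c\in L$, $ab=ac\neq 0$ implies $b=c$. Standing assumptions: $L$ is also compactly generated (every element is a join of compact elements), $1$ is compact and every finite product of compact elements is compact; $\delta:L\to L$ is an expansion function, i.e. $a\leqslant\delta(a)$ for all $a$, and $a\leqslant b$ implies $\delta(a)\leqslant\delta(b)$. An element $p$ is proper if $p<1$; $q$ is non-nilpotent if $q^n\neq 0$ for all positive integers $n$. A proper element $p$ is $\delta$-primary if for all $a,b\in L$, $ab\leqslant p$ implies $a\leqslant p$ or $b\leqslant\delta(p)$. For $\phi:L\to L$, a proper element $p$ is $\phi$-$\delta$-primary if for all $a,b\in L$, $ab\leqslant p$ and $ab\not\leqslant\phi(p)$ implies $a\leqslant p$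 or $b\leqslant\delta(p)$. $\phi_n(a)=a^n$, and $\gamma_1\leqslant\gamma_2$ for functions $L\to L$ means $\gamma_1(a)\leqslant\gamma_2(a)$ for all $a\in L$. *)

(* Defs.v *)
From HB Require Import structures.
From mathcomp Require Import ssreflect ssrfun ssrbool eqtype ssrnat seq choice.
From mathcomp Require Import fintype bigop monoid order.
From mathcomp Require Import boolp classical_sets cardinality.

Set Implicit Arguments.
Unset Strict Implicit.
Unset Printing Implicit Defensive.

Import Order.TTheory.

Local Open Scope group_scope.
Local Open Scope order_scope.

Definition bigjoin (d : Order.disp_t) (L : bPOrderType d) (A : set L) : L :=
  supremum \bot A.

HB.mixin Record TBLattice_isComplete (d : Order.disp_t) L
    of Order.TBLattice d L := {
  supremums_neq0 : forall A : set L, (supremums A !=set0)%classic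
}.

#[short(type="completeLatticeType")]
HB.structure Definition CompleteLattice (d : Order.disp_t) :=
  { L of Order.TBLattice d L & TBLattice_isComplete d L }.

(* Multiplicatively written monoid [*, 1], whose unit is the greatest element;
   the least element [\bot] is the 0 of the literature. *)
HB.mixin Record CompleteLattice_isMult (d : Order.disp_t) L
    of CompleteLattice d L & Monoid L := {
  mult_comm : @commutative L L *%g;
  mult_top : 1 = \top :> L;
  mult_bigjoinr : forall (a : L) (B : set L),
    a * bigjoin B = bigjoin [set a * b | b in B]%classic
}.

#[short(type="multLatticeType")]
HB.structure Definition MultLattice (d : Order.disp_t) :=
  { L of CompleteLattice d L & Monoid L & CompleteLattice_isMult d L }.

(* [bigjoin] is a total operator; this confirms that in a complete lattice it
   always is the least upper bound. *)
Lemma bigjoin_supremums (d : Order.disp_t) (L : completeLatticeType d)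
  (A : set L) : supremums A (bigjoin A).
Proof.
rewrite /bigjoin /supremum; case: ifPn => [/eqP ->|_]; last first.
  by case: xgetP => // no_sup; have [x /no_sup] := supremums_neq0 A.
by split=> [x //|y _]; exact: le0x.
Qed.

Section MultLatticeNotions.
Variables (d : Order.disp_t) (L : multLatticeType d).
Implicit Types (a b c e p q : L) (delta phi : L -> L).

Definition residual a b : L := bigjoin [set x | x * b <= a]%classic.

Definition meet_principal e : Prop :=
  forall a b, a `&` (b * e) = (residual a e `&` b) * e.

Definition join_principal e : Prop :=
  forall a b, residual ((a * e) `|` b) e = residual b e `|` a.

Definition principal e : Prop := meet_principal e /\ join_principal e.

Definition compact_elt c : Prop :=
  forall A : set L, c <= bigjoin A ->
    exists B : set L, [/\ finite_set B, (B `<=` A)%classic & c <= bigjoin B].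

Definition join_generated (G : set L) : Prop :=
  forall x : L, exists2 A : set L, (A `<=` G)%classic & x = bigjoin A.

Definition modular_lattice : Prop :=
  forall a b c, a <= c -> a `|` (b `&` c) = (a `|` b) `&` c.

Definition ascending_chain_condition : Prop :=
  forall u : nat -> L, {homo u : m n / (m <= n)%N >-> m <= n} ->
    exists N : nat, forall n : nat, (N <= n)%N -> u n = u N.

Definition noether_lattice : Prop :=
  [/\ modular_lattice, join_generated [set e | principal e]%classic
    & ascending_chain_condition].

Definition restricted_cancellation a : Prop :=
  forall b c, a * b = a * c -> a * b <> \bot -> b = c.

Definition expansion_function delta : Prop :=
  (forall a, a <= delta a) /\ (forall a b, a <= b -> delta a <= delta b).

Definition proper_elt p : Prop := p < 1.

Definition non_nilpotent q : Prop :=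
  forall n : nat, (0 < n)%N -> q ^+ n <> \bot.

Definition delta_primary delta p : Prop :=
  proper_elt p /\
  forall a b, a * b <= p -> a <= p \/ b <= delta p.

Definition phi_delta_primary phi delta p : Prop :=
  proper_elt p /\
  forall a b, a * b <= p -> ~ (a * b <= phi p) -> a <= p \/ b <= delta p.

Definition power_fun (n : nat) : L -> L := fun a => a ^+ n.

End MultLatticeNotions.

Arguments noether_lattice {d} L.
Arguments power_fun {d L} n a.

(* Main.v *)
Require Import Defs.
From mathcomp Require Import ssreflect ssrfun ssrbool eqtype ssrnat seq choice.
From mathcomp Require Import fintype bigop monoid order.
From mathcomp Require Import boolp classical_sets cardinality.

(** A [delta]-primary element is [phi]-[delta]-primary for every [phi], so one
    direction only needs a choice of [phi] below the power functions.

    Conversely, the single exponent 2 is enough.  Suppose [a b <= q].  The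
    hypothesis on [phi <= phi_2] settles the matter unless [a b <= q^2].  In
    that case replace [b] by [b \/ q]: the product [a (b \/ q) = a b \/ a q]
    is still below [q], and [b \/ q <= delta q] would give [b <= delta q], so
    the hypothesis settles the matter again unless [a q <= q^2].  But then
    [q (a \/ q) = q q], which is nonzero as [q] is non-nilpotent, and
    cancelling [q] gives [a \/ q = q], that is, [a <= q]
    ([restricted_cancellation_le]). *)

Set Implicit Arguments.
Unset Strict Implicit.
Unset Printing Implicit Defensive.

Import Order.TTheory.

Local Open Scope group_scope.
Local Open Scope order_scope.

Section MultLatticeTheory.
Variables (d : Order.disp_t) (L : multLatticeType d).
Implicit Types (a b p q : L) (delta phi : L -> L).

Lemma bigjoin_set2 a b : bigjoin [set a; b]%classic = a `|` b.
Proof.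
have [ub least] := bigjoin_supremums [set a; b]%classic.
apply/eqP; rewrite eq_le; apply/andP; split.
  by apply: least => _ [->|->]; rewrite ?leUl ?leUr.
by rewrite leUx; apply/andP; split; apply: ub; [left | right].
Qed.

Lemma mult_joinr a b p : a * (b `|` p) = (a * b) `|` (a * p).
Proof. by rewrite -!bigjoin_set2 mult_bigjoinr image_setU !image_set1. Qed.

Lemma mult_le_r a b : a * b <= b.
Proof.
rewrite mult_comm; apply/join_idPr; rewrite -[X in _ `|` X]mulg1.
by rewrite -mult_joinr mult_top joinx1 -mult_top mulg1.
Qed.

(** Joining with [q] turns the inequality [q * a <= q * q] into an equality of
    multiples of [q], the only form to which the cancellation law applies. *)
Lemma restricted_cancellation_le q a :
  restricted_cancellation q -> q * q <> \bot -> q * a <= q * q -> a <= q.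
Proof.
move=> q_rcl qq_neq0 le_qa_qq.
have join_qq : q * (a `|` q) = q * q by rewrite mult_joinr; apply/join_idPr.
by apply/join_idPr/q_rcl => //; rewrite join_qq.
Qed.

Lemma delta_primary_phi phi delta p :
  delta_primary delta p -> phi_delta_primary phi delta p.
Proof. by case=> p_proper prim; split=> // a b /prim. Qed.

Lemma phi2_delta_primary phi delta q :
    phi <= power_fun 2 -> restricted_cancellation q -> q * q <> \bot ->
  phi_delta_primary phi delta q -> delta_primary delta q.
Proof.
move=> /lefP/(_ q) le_phi q_rcl qq_neq0 [q_proper prim]; split=> // a b le_ab_q.
rewrite /power_fun expgS expg1 in le_phi.
have [le_ab_phi|] := pselect (a * b <= phi q); last exact: prim.
have [le_abq_phi|nle_abq_phi] := pselect (a * (b `|` q) <= phi q).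
  left; apply: (restricted_cancellation_le q_rcl qq_neq0).
  have := le_trans le_abq_phi le_phi.
  by rewrite mult_joinr leUx (mult_comm q a) => /andP[].
have le_abq_q : a * (b `|` q) <= q by rewrite mult_joinr leUx le_ab_q mult_le_r.
have [|] := prim _ _ le_abq_q nle_abq_phi; first by left.
by rewrite leUx => /andP[]; right.
Qed.

End MultLatticeTheory.

Theorem theorem2p20 (d : Order.disp_t) (L : multLatticeType d)
  (L_noether : noether_lattice L)
  (L_compact_gen : join_generated [set c : L | compact_elt c]%classic)
  (compact_one : compact_elt (1%g : L))
  (compact_prod : forall s : seq L, (forall x, x \in s -> compact_elt x) ->
     compact_elt (\prod_(x <- s) x)%g)
  (delta : L -> L) (delta_exp : expansion_function delta)
  (q : L) (q_neq0 : q <> \bot%O) (q_non_nilp : non_nilpotent q)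
  (q_proper : proper_elt q) (q_rcl : restricted_cancellation q) :
  (forall n : nat, (2 <= n)%N ->
     exists phi : L -> L,
       (phi <= power_fun n)%O /\
       phi_delta_primary phi delta q)
  <-> delta_primary delta q.
Proof.
split=> [prim | q_prim n _].
  have [phi [le_phi q_prim]] := prim 2 isT.
  apply: (phi2_delta_primary le_phi) => //.
  by have := q_non_nilp 2 isT; rewrite expgS expg1.
by exists (power_fun n); split; [exact: lexx | exact: delta_primary_phi].
Qed.
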